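(* Let $Q\ge 1$ and let $\mathscr{A}_1,\ldots,\mathscr{A}_Q$ be nonempty compact $\mathcal{H}$-sets of positive real matrices (the matrices within one $\mathscr{A}_i$ all have the same size, the sizes for different $i$ may differ). Let a system be formed by a series-parallel recursive connection of the $Q$ independently switching blocks corresponding to $\mathscr{A}_1,\ldots,\mathscr{A}_Q$, with input and output both in $\mathbb{R}^N$, and let $\mathscr{A}$ be the set of $N\times N$ matrices given by the Minkowski expression in $\mathscr{A}_1,\ldots,\mathscr{A}_Q$ corresponding to the structure of this connection. Then the stability and the stabilizability of the switching system $$x(n+1)=A(n)x(n),\qquad A(n)\in\mathscr{A},\quad n=0,1,2,\ldots,$$ are decided by maximizing, respectively minimizing, the spectral radius $\rho(A)$ over the single matrices $A\in\mathscr{A}$; that is: (a) the system is stable if and only if $\max_{A\in\mathscr{A}}\rho(A)<1$; (b) the system is stabilizable if and only if $\min_{A\in\mathscr{A}}\rho(A)<1$.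
   Context: For vectors $x,y\in\mathbb{R}^N$, write $x\ge y$ (resp. $x>y$) if every coordinate of $x$ is not less than (resp. strictly greater than) the corresponding coordinate of $y$. A matrix is positive if all its entries are strictly positive. Sets of matrices carry the topology of element-wise convergence, and $\rho(A)$ denotes the spectral radius of a square matrix $A$. $\mathcal{H}$-sets. A set $\mathscr{S}$ of positive matrices of a common size is called an $\mathcal{H}$-set if for every $\tilde A\in\mathscr{S}$ and every vector $x>0$ of matching dimension both of the following hold: (H1) either $Ax\ge\tilde Ax$ for all $A\in\mathscr{S}$, or there exists $\bar A\in\mathscr{S}$ with $\bar Ax\le\tilde Ax$ and $\bar Ax\ne\tilde Ax$; (H2) either $Ax\le\tilde Ax$ for all $A\in\mathscr{S}$, or there exists $\bar A\in\mathscr{S}$ with $\bar Ax\ge\tilde Ax$ and $\bar Ax\neq\tilde Ax$. Minkowski operations. $\mathscr{S}+\mathscr{T}=\{A+B: A\in\mathscr{S},\,B\in\mathscr{T}\}$ (admissible when the sizes coincide), $\mathscr{S}\mathscr{T}=\{AB: A\in\mathscr{S},\,B\in\mathscr{T}\}$ (admissible when the number of columns of the matrices in $\mathscr{S}$ equals the number of rows of the matrices in $\mathscr{T}$). Series-parallel recursive connections. The $i$-th block acts by $x_{\mathrm{out}}(n+1)=A_i(n)x_{\mathrm{in}}(n)$, where for each $n$ the matrix $A_i(n)$ is chosen arbitrarily from $\mathscr{A}_i$, independently of the other blocks. A series-parallel recursive connection is represented by a graph obtained from a single edge by recursively applying series and/or parallel extensions, with the blocks placed on the edges (one block per edge). The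 corresponding Minkowski expression is defined recursively: a single edge carrying block $i$ corresponds to the set $\mathscr{A}_i$; the parallel connection of two subsystems corresponding to sets $\mathscr{S}$ and $\mathscr{T}$ corresponds to $\mathscr{S}+\mathscr{T}$; their series connection, in which the output of the subsystem with set $\mathscr{T}$ is the input of the subsystem with set $\mathscr{S}$, corresponds to $\mathscr{S}\mathscr{T}$; all operations are required to be admissible. Each index $i=1,\ldots,Q$ occurs exactly once in the expression. For example, $\mathscr{A}=\mathscr{A}_3(\mathscr{A}_1+\mathscr{A}_2)+\mathscr{A}_4$. Stability. The system $x(n+1)=A(n)x(n)$, $A(n)\in\mathscr{A}$, is stable if for every sequence $A(0),A(1),\ldots\in\mathscr{A}$ (and every initial vector $x(0)\in\mathbb{R}^N$) the corresponding solution $x(n)$ tends to zero. It is stabilizable if there exists at least one sequence $A(0),A(1),\ldots\in\mathscr{A}$ such that $A(n)\cdots A(1)A(0)\to 0$ as $n\to\infty$. *)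

(* Defs.v *)
From HB Require Import structures.
From mathcomp Require Import all_boot all_order all_algebra.
From mathcomp Require Import complex.
From mathcomp Require Import all_classical all_reals all_analysis.

Set Implicit Arguments.
Unset Strict Implicit.
Unset Printing Implicit Defensive.

Import Order.TTheory GRing.Theory Num.Theory.
Import numFieldNormedType.Exports.

Local Open Scope classical_set_scope.
Local Open Scope ring_scope.

Definition vec_le (R : realType) (n : nat) (x y : 'cV[R]_n) : Prop :=
  forall i, x i 0 <= y i 0.

Definition vec_pos (R : realType) (n : nat) (x : 'cV[R]_n) : Prop :=
  forall i, 0 < x i 0.

Definition mx_pos (R : realType) (m n : nat) (A : 'M[R]_(m, n)) : Prop :=
  forall i j, 0 < A i j.

Definition Hset (R : realType) (m n : nat) (S : set 'M[R]_(m, n)) : Prop :=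
  (forall A, S A -> mx_pos A) /\
  forall (At : 'M[R]_(m, n)) (x : 'cV[R]_n), S At -> vec_pos x ->
    ((forall A, S A -> vec_le (At *m x) (A *m x)) \/
     (exists Ab, [/\ S Ab, vec_le (Ab *m x) (At *m x)
                   & Ab *m x <> At *m x])) /\
    ((forall A, S A -> vec_le (A *m x) (At *m x)) \/
     (exists Ab, [/\ S Ab, vec_le (At *m x) (Ab *m x)
                   & Ab *m x <> At *m x])).

Definition minkowski_add (R : realType) (m n : nat)
    (S T : set 'M[R]_(m, n)) : set 'M[R]_(m, n) :=
  [set A + B | A in S & B in T].

Definition minkowski_mul (R : realType) (m k n : nat)
    (S : set 'M[R]_(m, k)) (T : set 'M[R]_(k, n)) : set 'M[R]_(m, n) :=
  [set A *m B | A in S & B in T].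

(* [sp_conn r c m n]: series-parallel recursive connections, with output in
   R^m and input in R^n, of blocks indexed by 'I_Q; block i carries
   (r i) x (c i) matrices. Admissibility of the operations is enforced by the
   type indices. In [sp_series S T] the output of T is the input of S. *)
Inductive sp_conn (Q : nat) (r c : 'I_Q -> nat) : nat -> nat -> Type :=
| sp_block (i : 'I_Q) : sp_conn r c (r i) (c i)
| sp_parallel (m n : nat) :
    sp_conn r c m n -> sp_conn r c m n -> sp_conn r c m n
| sp_series (m k n : nat) :
    sp_conn r c m k -> sp_conn r c k n -> sp_conn r c m n.

Fixpoint sp_blocks (Q : nat) (r c : 'I_Q -> nat) (m n : nat)
    (e : sp_conn r c m n) : seq 'I_Q :=
  match e with
  | sp_block i => [:: i]
  | sp_parallel _ _ e1 e2 => sp_blocks e1 ++ sp_blocks e2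
  | sp_series _ _ _ e1 e2 => sp_blocks e1 ++ sp_blocks e2
  end.

Definition each_block_once (Q : nat) (r c : 'I_Q -> nat) (m n : nat)
    (e : sp_conn r c m n) : Prop :=
  forall i : 'I_Q, count_mem i (sp_blocks e) = 1%N.

Fixpoint sp_set (R : realType) (Q : nat) (r c : 'I_Q -> nat)
    (A : forall i : 'I_Q, set 'M[R]_(r i, c i)) (m n : nat)
    (e : sp_conn r c m n) : set 'M[R]_(m, n) :=
  match e in sp_conn _ _ m0 n0 return set 'M[R]_(m0, n0) with
  | sp_block i => A i
  | sp_parallel _ _ e1 e2 => minkowski_add (sp_set A e1) (sp_set A e2)
  | sp_series _ _ _ e1 e2 => minkowski_mul (sp_set A e1) (sp_set A e2)
  end.

(* The real supremum below is a maximum over a finite set, nonempty as soon as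
   0 < n; [complex.Re] only casts the real-valued complex modulus to R. *)
Definition spectral_radius (R : realType) (n : nat) (A : 'M[R]_n) : R :=
  sup [set complex.Re `|z| | z in
        [set z : R[i] | eigenvalue (map_mx (real_complex R) A) z]].

Definition stable (R : realType) (N : nat) (S : set 'M[R]_N) : Prop :=
  forall A : nat -> 'M[R]_N, (forall n, S (A n)) ->
  forall x : nat -> 'cV[R]_N, (forall n, x n.+1 = A n *m x n) ->
  x n @[n --> \oo] --> (0 : 'cV[R]_N).

(* [mx_prod A n] is A(n) ... A(1) A(0). *)
Fixpoint mx_prod (R : realType) (N : nat) (A : nat -> 'M[R]_N) (n : nat) :
    'M[R]_N :=
  match n with
  | 0%N => A 0%N
  | n'.+1 => A n'.+1 *m mx_prod A n'
  end.

Definition stabilizable (R : realType) (N : nat) (S : set 'M[R]_N) : Prop :=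
  exists2 A : nat -> 'M[R]_N, (forall n, S (A n)) &
  mx_prod A n @[n --> \oo] --> (0 : 'M[R]_N).

Definition is_max (R : realType) (E : set R) (v : R) : Prop :=
  E v /\ ubound E v.

Definition is_min (R : realType) (E : set R) (v : R) : Prop :=
  E v /\ lbound E v.

(* Main.v *)
(* H-sets of positive matrices are stable under Minkowski sums and products, so
   the set S of the connection is a compact H-set. Among all triples (A, x, t)
   with A in S, x a positive vector and A x <= t x, compactness gives one with t
   minimal. If B in S satisfies B x <= t x with B x <> t x, then positivity of B
   gives B (B x) < t (B x) in every coordinate, contradicting minimality. Hence
   A x = t x, and (H1) forces t x <= B x for all B in S. The same argument with
   the inequalities reversed, using (H2), yields a positive eigenvector x of some
   A in S with B x <= t x for all B in S. Pairing these inequalities with a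
   positive left eigenvector of B identifies t with the minimal, resp. maximal,
   spectral radius, while iterating them controls all products of matrices
   from S. Perron's theorem itself is the case where S is a singleton. *)

Require Import Defs.
From HB Require Import structures.
From mathcomp Require Import all_boot all_order all_algebra.
From mathcomp Require Import complex.
From mathcomp Require Import all_classical all_reals all_analysis.

Set Implicit Arguments.
Unset Strict Implicit.
Unset Printing Implicit Defensive.

Import Order.TTheory GRing.Theory Num.Theory.
Import numFieldNormedType.Exports.

Local Open Scope classical_set_scope.
Local Open Scope ring_scope.

(** * Entrywise convergence; compactness of Minkowski images and of the simplex *)

Lemma cvg_mx (R : numFieldType) (T : Type) (F : set_system T) (m n : nat)
    (f : T -> 'M[R]_(m, n)) (M : 'M[R]_(m, n)) :
  Filter F -> (forall i j, f x i j @[x --> F] --> M i j) ->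
  f x @[x --> F] --> M.
Proof.
move=> FF fM B [P nbhsP PB].
apply: (@filterS _ F _ (fun x => forall i j, P i j (f x i j))) => [x|].
  exact: PB.
by apply: filter_forall => i; apply: filter_forall => j; exact/fM/nbhsP.
Qed.

Lemma cvg_coord (R : numFieldType) (T : Type) (F : set_system T) (m n : nat)
    (f : T -> 'M[R]_(m, n)) (M : 'M[R]_(m, n)) i j :
  f x @[x --> F] --> M -> f x i j @[x --> F] --> M i j.
Proof.
move=> fM; apply: (cvg_comp f (fun N : 'M[R]_(m, n) => N i j) fM).
exact: coord_continuous.
Qed.

Lemma continuous_mulmx (R : numFieldType) (m k n : nat) :
  continuous (fun p : 'M[R]_(m, k) * 'M[R]_(k, n) => p.1 *m p.2).
Proof.
move=> p; apply: cvg_mx => i j; rewrite mxE.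
under eq_cvg do rewrite mxE.
apply: (cvg_big (@add_continuous R)) => l _; apply: cvgM.
  by apply: cvg_coord; exact: cvg_fst.
by apply: cvg_coord; exact: cvg_snd.
Qed.

Lemma continuous_addmx (R : numFieldType) (m n : nat) :
  continuous (fun p : 'M[R]_(m, n) * 'M[R]_(m, n) => p.1 + p.2).
Proof.
move=> p; apply: cvg_mx => i j; rewrite mxE.
under eq_cvg do rewrite mxE.
apply: cvgD.
  by apply: cvg_coord; exact: cvg_fst.
by apply: cvg_coord; exact: cvg_snd.
Qed.

Lemma compact_image2 (T U V : topologicalType) (f : T -> U -> V)
    (S1 : set T) (S2 : set U) :
  continuous (fun p : T * U => f p.1 p.2) ->
  compact S1 -> compact S2 -> compact [set f x y | x in S1 & y in S2].
Proof.
move=> cf c1 c2.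
have -> : [set f x y | x in S1 & y in S2] =
    (fun p : T * U => f p.1 p.2) @` (S1 `*` S2).
  apply/seteqP; split=> [_ [x xS [y yS <-]]|_ [[x y] [xS yS] <-]].
    by exists (x, y).
  by exists x => //; exists y.
apply: continuous_compact; last exact: compact_setX.
exact: continuous_subspaceT.
Qed.

Lemma closed_vec_le (R : realType) (T : topologicalType) (n : nat)
    (f g : T -> 'cV[R]_n) :
  continuous f -> continuous g -> closed [set p | vec_le (f p) (g p)].
Proof.
move=> cf cg.
have -> : [set p | vec_le (f p) (g p)] =
    \bigcap_i ((fun p => g p i 0 - f p i 0) @^-1` [set x : R | 0 <= x]).
  apply/seteqP; split=> p /= H i => [_|]; first by rewrite /= subr_ge0.
  by have := H i I; rewrite /= subr_ge0.
apply: closed_bigI => i _; apply: preimage_closed; last exact: closed_ge.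
move=> p _; apply: cvgB.
  by apply: cvg_coord; exact: cg.
by apply: cvg_coord; exact: cf.
Qed.

Definition simplex (R : realType) (n : nat) : set 'cV[R]_n :=
  [set x | (forall i, 0 <= x i 0) /\ \sum_i x i 0 = 1].

Lemma compact_simplex (R : realType) (n : nat) : compact (@simplex R n).
Proof.
(* The simplex is a closed subset of the unit cube, whose compactness is carried over from row
   vectors by transposition. *)
have cbox : compact [set x : 'cV[R]_n | forall i, 0 <= x i 0 <= 1].
  have -> : [set x : 'cV[R]_n | forall i, 0 <= x i 0 <= 1] =
      trmx @` [set v : 'rV[R]_n | forall i, `[0, 1]%classic (v ord0 i)].
    apply/seteqP; split=> [x xP|_ [v vP <-] i]; last first.
      by have := vP i; rewrite /= in_itv /= mxE.
    by exists x^T; rewrite ?trmxK // => i; rewrite /= in_itv /= mxE.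
  apply: continuous_compact; last first.
    by apply: (@rV_compact R n (fun=> _)) => i; exact: segment_compact.
  apply: continuous_subspaceT => v; apply: (@cvg_mx R _ (nbhs v)) => i j.
  rewrite mxE.
  by under eq_cvg do rewrite mxE; exact: coord_continuous.
apply: (subclosed_compact _ cbox) => [|x [x0 x1] i]; last first.
  rewrite x0 -x1 (bigD1 i) //= lerDl; exact: sumr_ge0.
have csum : continuous (fun x : 'cV[R]_n => \sum_i x i 0).
  apply: continuous_big => [|i _]; [exact: add_continuous|].
  exact: coord_continuous.
have cge : closed [set x : 'cV[R]_n | forall i, 0 <= x i 0].
  have -> : [set x : 'cV[R]_n | forall i, 0 <= x i 0] = [set x | vec_le 0 x].
    by apply/seteqP; split=> x /= xP i; have := xP i; rewrite ?mxE.
  have c0 : continuous (fun _ : 'cV[R]_n => 0 : 'cV[R]_n).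
    exact: cst_continuous.
  by apply: (closed_vec_le c0) => x; exact.
apply: (closedI cge); apply: (@preimage_closed _ _ _ [set 1 : R]).
  by move=> x _; exact: csum.
exact: closed_eq.
Qed.

(** * Positive matrices and the coordinatewise order *)

Lemma mulmx_col_ge0 (R : realType) (m n : nat) (A : 'M[R]_(m, n))
    (x : 'cV[R]_n) :
  mx_pos A -> (forall i, 0 <= x i 0) -> forall i, 0 <= (A *m x) i 0.
Proof.
move=> A0 x0 i; rewrite mxE sumr_ge0 // => j _.
by rewrite mulr_ge0 // ltW.
Qed.

(** A zero coordinate of [A *m x] would be a vanishing sum of nonnegative terms [A i j * x j 0] with
    [A i j > 0], forcing [x = 0]. All strict inequalities below rest on this. *)
Lemma mulmx_col_gt0 (R : realType) (m n : nat) (A : 'M[R]_(m, n))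
    (x : 'cV[R]_n) :
  mx_pos A -> (forall i, 0 <= x i 0) -> x <> 0 -> vec_pos (A *m x).
Proof.
move=> A0 x0 xN0 i; rewrite lt_neqAle mulmx_col_ge0 // andbT eq_sym.
apply/eqP => Ax0; apply: xN0; apply/matrixP => j k; rewrite ord1 mxE.
move: Ax0; rewrite mxE => /psumr_eq0P Ax0; apply/eqP.
have /eqP := Ax0 (fun l _ => mulr_ge0 (ltW (A0 i l)) (x0 l)) j isT.
by rewrite mulf_eq0 gt_eqF.
Qed.

Lemma vec_pos_neq0 (R : realType) (n : nat) (x : 'cV[R]_n) :
  (0 < n)%N -> vec_pos x -> x <> 0.
Proof. by move=> n0 x0 xE; have := x0 (Ordinal n0); rewrite xE mxE ltxx. Qed.

Lemma mulmx_vec_pos (R : realType) (m n : nat) (A : 'M[R]_(m, n))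
    (x : 'cV[R]_n) :
  (0 < n)%N -> mx_pos A -> vec_pos x -> vec_pos (A *m x).
Proof.
move=> n0 A0 x0; apply: mulmx_col_gt0 => //; last exact: vec_pos_neq0.
by move=> i; exact/ltW.
Qed.

Lemma vec_le_trans (R : realType) (n : nat) (y x z : 'cV[R]_n) :
  vec_le x y -> vec_le y z -> vec_le x z.
Proof. by move=> xy yz i; exact: le_trans (xy i) (yz i). Qed.

Lemma vec_le_mulmx (R : realType) (m n : nat) (A : 'M[R]_(m, n))
    (x y : 'cV[R]_n) :
  mx_pos A -> vec_le x y -> vec_le (A *m x) (A *m y).
Proof.
move=> A0 xy i; rewrite -subr_ge0.
have -> : (A *m y) i 0 - (A *m x) i 0 = (A *m (y - x)) i 0.
  by rewrite mulmxBr !mxE.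
by apply: mulmx_col_ge0 => // j; rewrite !mxE subr_ge0.
Qed.

Lemma vec_lt_mulmx (R : realType) (m n : nat) (A : 'M[R]_(m, n))
    (x y : 'cV[R]_n) :
  mx_pos A -> vec_le x y -> x <> y -> vec_pos (A *m y - A *m x).
Proof.
move=> A0 xy xNy; rewrite -mulmxBr; apply: mulmx_col_gt0 => //.
  by move=> i; rewrite !mxE subr_ge0.
by move=> /eqP; rewrite subr_eq0 eq_sym => /eqP.
Qed.

(** Take for [s] the largest of the finitely many ratios [y i 0 / x i 0]. This turns a strict
    inequality in every coordinate into room for lowering [t]. *)
Lemma vec_lt_scale (R : realType) (n : nat) (x y : 'cV[R]_n) (t : R) :
  (0 < n)%N -> vec_pos x -> vec_pos (t *: x - y) ->
  exists2 s, s < t & vec_le y (s *: x).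
Proof.
move=> n0 x0 yltx; pose f i := y i 0 / x i 0.
have [i _ imax] := @arg_maxP _ _ _ (Ordinal n0) predT f isT.
exists (f i) => [|j].
  by rewrite /f ltr_pdivrMr //; have := yltx i; rewrite !mxE subr_gt0.
by rewrite mxE -ler_pdivrMr //; exact: imax.
Qed.

Lemma vec_gt_scale (R : realType) (n : nat) (x y : 'cV[R]_n) (t : R) :
  (0 < n)%N -> vec_pos x -> vec_pos (y - t *: x) ->
  exists2 s, t < s & vec_le (s *: x) y.
Proof.
move=> n0 x0 xlty; have [|s st ys] := @vec_lt_scale R n x (- y) (- t) n0 x0.
  by rewrite scaleNr opprK addrC.
exists (- s); first by rewrite ltrNr.
by move=> i; have := ys i; rewrite !mxE mulNr lerNl.
Qed.

(** * Extremal triples of Collatz-Wielandt type over a compact set of positive matrices *)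

Lemma simplex_neq0 (R : realType) (n : nat) (x : 'cV[R]_n) :
  simplex x -> x <> 0.
Proof.
move=> [_ x1] x0; move/eqP: x1; rewrite x0 big1 ?(eq_sym 0) ?oner_eq0 //.
by move=> i _; rewrite mxE.
Qed.

Lemma simplex_normalize (R : realType) (n : nat) (x : 'cV[R]_n) :
  (0 < n)%N -> vec_pos x -> exists2 a, 0 < a & simplex (a *: x).
Proof.
move=> n0 x0; have s0 : 0 < \sum_i x i 0.
  rewrite (bigD1 (Ordinal n0)) //= ltr_wpDr // sumr_ge0 // => i _.
  exact: ltW.
exists (\sum_i x i 0)^-1; first by rewrite invr_gt0.
split=> [i|]; first by rewrite mxE mulr_ge0 ?invr_ge0 ?ltW.
by under eq_bigr do rewrite mxE; rewrite -mulr_sumr mulVf // gt_eqF.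
Qed.

Lemma vec_le_scale (R : realType) (n : nat) (a : R) (x y : 'cV[R]_n) :
  0 < a -> vec_le x y -> vec_le (a *: x) (a *: y).
Proof. by move=> a0 xy i; rewrite !mxE ler_pM2l. Qed.

(* The bound T on the third component makes the box compact; it is chosen large
   enough not to affect the extremal value of t. *)
Definition collatz_box (R : realType) (n : nat) (S : set 'M[R]_n) (T : R) :
    set ('M[R]_n * 'cV[R]_n * R) := (S `*` @simplex R n) `*` `[0, T]%classic.

Lemma compact_collatz_box (R : realType) (n : nat) (S : set 'M[R]_n) (T : R) :
  compact S -> compact (collatz_box S T).
Proof.
move=> cS; apply: compact_setX; last exact: segment_compact.
by apply: compact_setX => //; exact: compact_simplex.
Qed.

Lemma continuous_collatz_mul (R : realType) (n : nat) :
  continuous (fun p : 'M[R]_n * 'cV[R]_n * R => p.1.1 *m p.1.2).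
Proof.
move=> p; apply: (cvg_comp fst
  (fun q : 'M[R]_n * 'cV[R]_n => q.1 *m q.2) cvg_fst).
exact: continuous_mulmx.
Qed.

Lemma continuous_collatz_scale (R : realType) (n : nat) :
  continuous (fun p : 'M[R]_n * 'cV[R]_n * R => p.2 *: p.1.2).
Proof.
move=> p; apply: cvg_mx => i j; rewrite mxE; under eq_cvg do rewrite mxE.
apply: cvgM; first exact: cvg_snd.
apply: cvg_coord; exact: (cvg_comp fst snd cvg_fst cvg_snd).
Qed.

(* The extremal x of the compact box is only nonnegative; A x is positive and
   satisfies the same inequality. *)
Lemma collatz_min (R : realType) (n : nat) (S : set 'M[R]_n) :
  (0 < n)%N -> S !=set0 -> compact S -> (forall A, S A -> mx_pos A) ->
  exists A x t, [/\ S A, vec_pos x, vec_le (A *m x) (t *: x) &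
    forall B y s, S B -> vec_pos y -> vec_le (B *m y) (s *: y) -> t <= s].
Proof.
(* [T] is the sum of all entries of [A0]. It dominates every row sum, so the all-ones vector is
   feasible for [A0] at level [T] and the box is nonempty. *)
move=> n0 [A0 SA0] cS Spos; set T := \sum_i (A0 *m const_mx 1 : 'cV_n) i 0.
pose K := collatz_box S T `&`
  [set p | vec_le (p.1.1 *m p.1.2) (p.2 *: p.1.2)].
have cK : compact K.
  apply: compact_closedI; first exact: compact_collatz_box.
  apply: closed_vec_le; [exact: continuous_collatz_mul|].
  exact: continuous_collatz_scale.
have ones0 : vec_pos (const_mx 1 : 'cV[R]_n) by move=> i; rewrite mxE.
have row0 i := mulmx_vec_pos n0 (Spos _ SA0) ones0 i.
(* The inequality is homogeneous in [y], so [y] may be scaled into the simplex; [0 <= s] follows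
   from [B *m y] being positive. *)
have feasible B y s : S B -> vec_pos y -> vec_le (B *m y) (s *: y) -> s <= T ->
    exists z, K (B, z, s).
  move=> SB y0 Bys sT; have [a a0 ay] := simplex_normalize n0 y0.
  exists (a *: y); split; last first.
    by rewrite /= -scalemxAr scalerA mulrC -scalerA; exact: vec_le_scale.
  split=> //=; rewrite in_itv /= sT andbT; pose i := Ordinal n0.
  have := lt_le_trans (mulmx_vec_pos n0 (Spos _ SB) y0 i) (Bys i).
  by rewrite mxE pmulr_lgt0 // => /ltW.
have [z0 Kz0] : exists z, K (A0, z, T).
  apply: (feasible _ (const_mx 1)) => // i.
  rewrite [leRHS]mxE [X in _ * X]mxE mulr1 /T (bigD1 i) //= lerDl.
  by rewrite sumr_ge0 // => j _; exact/ltW.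
have K0 : K !=set0 by exists (A0, z0, T).
have csnd : {within K, continuous snd}.
  by apply: continuous_subspaceT => p; exact: cvg_snd.
have [[[A x] t] KA tmin] := compact_EVT_min K0 cK csnd.
have [[[/= SA xS] tT] Axt] := set_mem KA.
exists A, (A *m x), t; split=> //.
- by apply: mulmx_col_gt0; [exact: Spos|exact: xS.1|exact: simplex_neq0].
- by rewrite scalemxAr; apply: vec_le_mulmx => //; exact: Spos.
move=> B y s SB y0 Bys; have [sT|Ts] := leP s T; last first.
  by move: tT; rewrite in_itv /= => /andP[_ tT]; exact: le_trans tT (ltW Ts).
by have [z Kz] := feasible _ _ _ SB y0 Bys sT; apply: (tmin (B, z, s));
   rewrite inE.
Qed.

(** Here the bound on [t] needs an argument: for [x] in the simplex, summing the coordinates of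
    [s *: x <= B *m x] and using [x j 0 <= 1] bounds [s] by the sum of the entries of [B]. That sum
    is continuous in [B], so it has a maximum [T] on [S]. As for the minimum, the extremal [x] is
    replaced by [A *m x] to make it positive. *)
Lemma collatz_max (R : realType) (n : nat) (S : set 'M[R]_n) :
  (0 < n)%N -> S !=set0 -> compact S -> (forall A, S A -> mx_pos A) ->
  exists A x t, [/\ S A, vec_pos x, vec_le (t *: x) (A *m x) &
    forall B y s, S B -> vec_pos y -> vec_le (s *: y) (B *m y) -> s <= t].
Proof.
move=> n0 S0 cS Spos; pose mass (B : 'M[R]_n) := \sum_i \sum_j B i j.
have cmass : {within S, continuous mass}.
  apply: continuous_subspaceT; apply: continuous_big => [|i _].
    exact: add_continuous.
  apply: continuous_big => [|j _]; [exact: add_continuous|].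
  exact: coord_continuous.
have [A0 /set_mem SA0 massT] := compact_EVT_max S0 cS cmass.
set T := mass A0 in massT.
pose K := collatz_box S T `&`
  [set p | vec_le (p.2 *: p.1.2) (p.1.1 *m p.1.2)].
have cK : compact K.
  apply: compact_closedI; first exact: compact_collatz_box.
  apply: closed_vec_le; first exact: continuous_collatz_scale.
  exact: continuous_collatz_mul.
have feasible B y s : S B -> vec_pos y -> vec_le (s *: y) (B *m y) -> 0 <= s ->
    exists z, K (B, z, s).
  move=> SB y0 sBy s0; have [a a0 ay] := simplex_normalize n0 y0.
  have saBy : vec_le (s *: (a *: y)) (B *m (a *: y)).
    by rewrite -scalemxAr scalerA mulrC -scalerA; exact: vec_le_scale.
  exists (a *: y); split=> //; split=> //=; rewrite in_itv /= s0 /=.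
  have [z0 z1] := ay; apply: le_trans (massT B (mem_set SB)).
  rewrite -[s]mulr1 -z1 mulr_sumr; apply: ler_sum => i _.
  have := saBy i; rewrite mxE => /le_trans; apply.
  rewrite mxE; apply: ler_sum => j _.
  rewrite ler_piMr ?(ltW (Spos _ SB _ _)) //.
  by rewrite -z1 (bigD1 j) //= lerDl sumr_ge0.
have [z0 Kz0] : exists z, K (A0, z, 0).
  have one0 : vec_pos (const_mx 1 : 'cV[R]_n) by move=> i; rewrite mxE.
  apply: (feasible _ (const_mx 1)) => // i; rewrite scale0r mxE.
  by apply/ltW/mulmx_vec_pos => //; exact: Spos.
have K0 : K !=set0 by exists (A0, z0, 0).
have csnd : {within K, continuous snd}.
  by apply: continuous_subspaceT => p; exact: cvg_snd.
have [[[A x] t] KA tmax] := compact_EVT_max K0 cK csnd.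
have [[[/= SA xS] tT] Axt] := set_mem KA.
exists A, (A *m x), t; split=> //.
- by apply: mulmx_col_gt0; [exact: Spos|exact: xS.1|exact: simplex_neq0].
- by rewrite scalemxAr; apply: vec_le_mulmx => //; exact: Spos.
move=> B y s SB y0 Bys; have [s0|s0] := leP 0 s; last first.
  by move: tT; rewrite in_itv /= => /andP[t0 _]; exact: le_trans (ltW s0) t0.
by have [z Kz] := feasible _ _ _ SB y0 Bys s0; apply: (tmax (B, z, s));
   rewrite inE.
Qed.

(** * Positive eigenvectors extremal for a whole H-set *)

Lemma Hset_min_eigen (R : realType) (n : nat) (S : set 'M[R]_n) :
  (0 < n)%N -> S !=set0 -> compact S -> Hset S ->
  exists A x t, [/\ S A, vec_pos x, A *m x = t *: x &
    forall B, S B -> vec_le (t *: x) (B *m x)].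
Proof.
move=> n0 S0 cS [Spos SH].
have [A [x [t [SA x0 Axt tmin]]]] := collatz_min n0 S0 cS Spos.
(* Otherwise [B *m x] in place of [x] satisfies the inequality strictly in every coordinate, hence
   with some [s < t], against minimality. *)
have rigid B : S B -> vec_le (B *m x) (t *: x) -> B *m x = t *: x.
  move=> SB Bxt; apply: contrapT => Bxt'.
  have Bx0 := mulmx_vec_pos n0 (Spos _ SB) x0.
  have := vec_lt_mulmx (Spos _ SB) Bxt Bxt'; rewrite -scalemxAr.
  move=> /(vec_lt_scale n0 Bx0)[s st /(tmin _ _ _ SB Bx0)].
  by rewrite leNgt st.
have Ax := rigid A SA Axt; exists A, x, t; split=> //; rewrite -Ax.
(* The second alternative of (H1) at [A] and [x] provides a [B] that [rigid] excludes. *)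
have [[//|[B [SB Bx Bx']]] _] := SH A x SA x0; exfalso; apply: Bx'.
by rewrite Ax; apply: rigid => //; rewrite -Ax.
Qed.

Lemma Hset_max_eigen (R : realType) (n : nat) (S : set 'M[R]_n) :
  (0 < n)%N -> S !=set0 -> compact S -> Hset S ->
  exists A x t, [/\ S A, vec_pos x, A *m x = t *: x &
    forall B, S B -> vec_le (B *m x) (t *: x)].
Proof.
move=> n0 S0 cS [Spos SH].
have [A [x [t [SA x0 Axt tmax]]]] := collatz_max n0 S0 cS Spos.
have rigid B : S B -> vec_le (t *: x) (B *m x) -> B *m x = t *: x.
  move=> SB Bxt; apply: contrapT => Bxt'.
  have Bx0 := mulmx_vec_pos n0 (Spos _ SB) x0.
  have := vec_lt_mulmx (Spos _ SB) Bxt (nesym Bxt'); rewrite -scalemxAr.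
  move=> /(vec_gt_scale n0 Bx0)[s st /(tmax _ _ _ SB Bx0)].
  by rewrite leNgt st.
have Ax := rigid A SA Axt; exists A, x, t; split=> //; rewrite -Ax.
have [_ [//|[B [SB Bx Bx']]]] := SH A x SA x0; exfalso; apply: Bx'.
by rewrite Ax; apply: rigid => //; rewrite -Ax.
Qed.

(** * Perron vectors and the spectral radius *)

Lemma Hset1 (R : realType) (m n : nat) (M : 'M[R]_(m, n)) :
  mx_pos M -> Hset [set M].
Proof.
by move=> M0; split=> [_ -> //|_ x -> _]; split; left=> _ -> i; exact: lexx.
Qed.

Lemma perron_vector (R : realType) (n : nat) (M : 'M[R]_n) :
  (0 < n)%N -> mx_pos M -> exists x t, vec_pos x /\ M *m x = t *: x.
Proof.
move=> n0 M0.
have [|_ [x [t [-> x0 Mx _]]]] :=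
  Hset_min_eigen n0 _ (@compact_set1 _ M) (Hset1 M0).
  by exists M.
by exists x, t.
Qed.

(** Eigenvectors here are rows: [w *m M = z *: w]. Taking moduli gives [|z| |w| <= |w| M] entrywise,
    and pairing with [x] gives [|z| (|w| x) <= |w| M x <= t (|w| x)], where [|w| x > 0] cancels. *)
Lemma eigenvalue_norm_le (R : realType) (n : nat) (M : 'M[R]_n) (x : 'cV[R]_n)
    (t : R) (z : R[i]) :
  mx_pos M -> vec_pos x -> vec_le (M *m x) (t *: x) ->
  eigenvalue (map_mx (real_complex R) M) z -> complex.Re `|z| <= t.
Proof.
move=> M0 x0 Mxt /eigenvalueP[w wM wN0].
pose xc i : R[i] := (x i 0)%:C%C.
have xc0 i : 0 < xc i by rewrite ltcR.
have [i0 wi0] : exists i, w 0 i != 0.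
  by apply/rV0Pn.
have s0 : 0 < \sum_i `|w 0 i| * xc i.
  rewrite (bigD1 i0) //= ltr_wpDr //; last by rewrite mulr_gt0 ?normr_gt0.
  by rewrite sumr_ge0 // => i _; rewrite mulr_ge0 // ltW.
suff : `|z| * (\sum_i `|w 0 i| * xc i) <= t%:C%C * (\sum_i `|w 0 i| * xc i).
  rewrite ler_pM2r // => zt.
  by move: zt; rewrite lecE /= => /andP[].
rewrite !mulr_sumr.
have key j : `|z| * `|w 0 j| <= \sum_i `|w 0 i| * (M i j)%:C%C.
  have /rowP/(_ j) := wM; rewrite !mxE => wMj; rewrite -normrM -wMj.
  apply: (le_trans (ler_norm_sum _ _ _)); apply: ler_sum => i _.
  by rewrite mxE normrM (ger0_norm (_ : 0 <= (M i j)%:C%C)) // lecR ltW.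
apply: (@le_trans _ _ (\sum_j (\sum_i `|w 0 i| * (M i j)%:C%C) * xc j)).
  by apply: ler_sum => j _; rewrite mulrA ler_wpM2r ?key // ltW.
under eq_bigr do rewrite mulr_suml.
rewrite exchange_big /=; apply: ler_sum => i _.
rewrite mulrCA; under eq_bigr do rewrite -mulrA.
rewrite -mulr_sumr ler_wpM2l //.
have := Mxt i; rewrite !mxE -lecR rmorphM rmorph_sum /=.
by under eq_bigr do rewrite rmorphM.
Qed.

Lemma left_eigen_pairing (R : realType) (n : nat) (M : 'M[R]_n) (u x : 'cV[R]_n)
    (s : R) :
  M^T *m u = s *: u ->
  (u^T *m (M *m x)) 0 0 = (u^T *m (s *: x)) 0 0.
Proof.
move=> Mu; rewrite mulmxA -[M]trmxK -trmx_mul Mu linearZ /=.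
by rewrite -scalemxAl scalemxAr.
Qed.

Lemma pairing_scale_le (R : realType) (n : nat) (u x : 'cV[R]_n) (s t : R) :
  (0 < n)%N -> vec_pos u -> vec_pos x ->
  (u^T *m (s *: x)) 0 0 <= (u^T *m (t *: x)) 0 0 -> s <= t.
Proof.
move=> n0 u0 x0.
have scaleE k : (u^T *m (k *: x)) 0 0 = k * (u^T *m x) 0 0.
  by rewrite -scalemxAr mxE.
rewrite !scaleE ler_pM2r //.
by apply: mulmx_vec_pos => // i j; rewrite mxE ord1.
Qed.

(** The row [u^T] is an eigenvector, so [s] is one of the moduli. For the upper bound, a positive
    right eigenvector [x] with eigenvalue [t] bounds every modulus by [t], and pairing [x] with [u]
    gives [t <= s]. *)
Lemma spectral_radius_eigen (R : realType) (n : nat) (M : 'M[R]_n)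
    (u : 'cV[R]_n) (s : R) :
  (0 < n)%N -> mx_pos M -> vec_pos u -> M^T *m u = s *: u ->
  spectral_radius M = s.
Proof.
move=> n0 M0 u0 Mu; set E := [set complex.Re `|z| | z in
  [set z : R[i] | eigenvalue (map_mx (real_complex R) M) z]].
have s0 : 0 <= s.
  have MT0 : mx_pos M^T by move=> i j; rewrite mxE.
  have := mulmx_vec_pos n0 MT0 u0 (Ordinal n0).
  by rewrite Mu mxE pmulr_lgt0 // => /ltW.
have Es : E s.
  exists s%:C%C; last by rewrite ger0_norm // lecR.
  apply/eigenvalueP; exists (map_mx (real_complex R) u^T).
    rewrite -map_mxM -[M]trmxK -trmx_mul Mu; apply/rowP => j.
    by rewrite !mxE rmorphM.
  apply/rV0Pn; exists (Ordinal n0).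
  by rewrite !mxE (_ : 0 = 0%:C%C) // (inj_eq (@complexI _)) gt_eqF.
have ubs : ubound E s.
  have [x [t [x0 Mx]]] := perron_vector n0 M0.
  have ts : t <= s.
    by apply: (pairing_scale_le n0 u0 x0);
       rewrite -Mx (left_eigen_pairing x Mu).
  move=> _ [z zM <-]; apply: (eigenvalue_norm_le M0 x0 _ zM) => i.
  by rewrite Mx !mxE ler_wpM2r // ltW.
apply/eqP; rewrite eq_le ge_sup ?ub_le_sup //; first by exists s.
by exists s.
Qed.

Lemma spectral_radius_perron (R : realType) (n : nat) (M : 'M[R]_n) :
  (0 < n)%N -> mx_pos M ->
  exists2 u, vec_pos u & M^T *m u = spectral_radius M *: u.
Proof.
move=> n0 M0; have MT0 : mx_pos M^T by move=> i j; rewrite mxE.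
have [u [s [u0 Mu]]] := perron_vector n0 MT0.
by exists u; rewrite ?(spectral_radius_eigen n0 M0 u0 Mu).
Qed.

(** For a positive left eigenvector [u], the pairing gives [rho u^T x = u^T M x <= t u^T x], and
    [u^T x > 0] cancels. *)
Lemma spectral_radius_le (R : realType) (n : nat) (M : 'M[R]_n) (x : 'cV[R]_n)
    (t : R) :
  (0 < n)%N -> mx_pos M -> vec_pos x -> vec_le (M *m x) (t *: x) ->
  spectral_radius M <= t.
Proof.
move=> n0 M0 x0 Mx; have [u u0 Mu] := spectral_radius_perron n0 M0.
apply: (pairing_scale_le n0 u0 x0); rewrite -(left_eigen_pairing _ Mu).
by apply: vec_le_mulmx => // i j; rewrite mxE ord1.
Qed.

Lemma spectral_radius_ge (R : realType) (n : nat) (M : 'M[R]_n) (x : 'cV[R]_n)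
    (t : R) :
  (0 < n)%N -> mx_pos M -> vec_pos x -> vec_le (t *: x) (M *m x) ->
  t <= spectral_radius M.
Proof.
move=> n0 M0 x0 Mx; have [u u0 Mu] := spectral_radius_perron n0 M0.
apply: (pairing_scale_le n0 u0 x0); rewrite -(left_eigen_pairing _ Mu).
by apply: vec_le_mulmx => // i j; rewrite mxE ord1.
Qed.

(** * Closure of compact H-sets under the Minkowski operations *)

(** If one summand is not extremal at [x], improve it alone and keep the other; cancellation
    preserves distinctness. If both are extremal, add the two inequalities. *)
Lemma Hset_add (R : realType) (m n : nat) (S T : set 'M[R]_(m, n)) :
  Hset S -> Hset T -> Hset (minkowski_add S T).
Proof.
move=> [S0 SH] [T0 TH]; split=> [_ [A SA [B TB <-]] i j|].
  by rewrite mxE; apply: addr_gt0; [exact: S0|exact: T0].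
move=> _ x [A SA [B TB <-]] x0.
have [SH1 SH2] := SH A x SA x0; have [TH1 TH2] := TH B x TB x0.
have le_add (a b c d : 'cV[R]_m) :
    vec_le a b -> vec_le c d -> vec_le (a + c) (b + d).
  by move=> ab cd i; rewrite [leLHS]mxE [leRHS]mxE lerD.
split.
  case: SH1 => [SA1|[A' [SA' AA' AN]]]; last first.
    right; exists (A' + B); split; first by exists A' => //; exists B.
      by rewrite !mulmxDl; apply: le_add => // i; exact: lexx.
    by rewrite !mulmxDl => /addIr.
  case: TH1 => [TB1|[B' [TB' BB' BN]]]; last first.
    right; exists (A + B'); split; first by exists A => //; exists B'.
      by rewrite !mulmxDl; apply: le_add => // i; exact: lexx.
    by rewrite !mulmxDl => /addrI.
  left=> _ [A' SA' [B' TB' <-]]; rewrite !mulmxDl.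
  by apply: le_add; [apply: SA1|apply: TB1].
case: SH2 => [SA1|[A' [SA' AA' AN]]]; last first.
  right; exists (A' + B); split; first by exists A' => //; exists B.
    by rewrite !mulmxDl; apply: le_add => // i; exact: lexx.
  by rewrite !mulmxDl => /addIr.
case: TH2 => [TB1|[B' [TB' BB' BN]]]; last first.
  right; exists (A + B'); split; first by exists A => //; exists B'.
    by rewrite !mulmxDl; apply: le_add => // i; exact: lexx.
  by rewrite !mulmxDl => /addrI.
left=> _ [A' SA' [B' TB' <-]]; rewrite !mulmxDl.
by apply: le_add; [apply: SA1|apply: TB1].
Qed.

Lemma vec_pos_sub_neq (R : realType) (n : nat) (x y : 'cV[R]_n) :
  (0 < n)%N -> vec_pos (y - x) -> y <> x.
Proof.
by move=> n0 + xy; rewrite xy subrr => /(_ (Ordinal n0)); rewrite mxE ltxx.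
Qed.

(** The alternatives are those of [T] at [x] and of [S] at the positive vector [B *m x]. Improving
    [B] changes every coordinate after multiplication by the positive [A], so distinctness survives.
    If [B] is extremal but [A] is not, improve [A]. If both are extremal, compare [A' B' x] with
    [A' B x] and then with [A B x]. *)
Lemma Hset_mul (R : realType) (m k n : nat) (S : set 'M[R]_(m, k))
    (T : set 'M[R]_(k, n)) :
  (0 < m)%N -> (0 < k)%N -> (0 < n)%N ->
  Hset S -> Hset T -> Hset (minkowski_mul S T).
Proof.
move=> m0 k0 n0 [S0 SH] [T0 TH]; split=> [_ [A SA [B TB <-]] i j|].
  rewrite mxE (bigD1 (Ordinal k0)) //= ltr_wpDr //; last first.
    by apply: mulr_gt0; [exact: S0|exact: T0].
  by apply: sumr_ge0 => l _; apply/ltW/mulr_gt0; [exact: S0|exact: T0].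
move=> _ x [A SA [B TB <-]] x0; have A0 := S0 A SA.
have Bx0 := mulmx_vec_pos n0 (T0 B TB) x0.
have [SH1 SH2] := SH A (B *m x) SA Bx0; have [TH1 TH2] := TH B x TB x0.
split.
  case: TH1 => [TB1|[B' [TB' BB' BN]]]; last first.
    right; exists (A *m B'); split; first by exists A => //; exists B'.
      by rewrite -!mulmxA; exact: vec_le_mulmx.
    rewrite -!mulmxA; apply: nesym; apply: vec_pos_sub_neq => //.
    exact: vec_lt_mulmx.
  case: SH1 => [SA1|[A' [SA' AA' AN]]]; last first.
    right; exists (A' *m B); rewrite -!mulmxA; split=> //.
    by exists A' => //; exists B.
  left=> _ [A' SA' [B' TB' <-]]; rewrite -!mulmxA.
  apply: vec_le_trans (SA1 _ SA') _.
  by apply: vec_le_mulmx; [exact: S0|exact: TB1].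
case: TH2 => [TB1|[B' [TB' BB' BN]]]; last first.
  right; exists (A *m B'); split; first by exists A => //; exists B'.
    by rewrite -!mulmxA; exact: vec_le_mulmx.
  rewrite -!mulmxA; apply: vec_pos_sub_neq => //.
  by apply: vec_lt_mulmx => //; exact: nesym.
case: SH2 => [SA1|[A' [SA' AA' AN]]]; last first.
  right; exists (A' *m B); rewrite -!mulmxA; split=> //.
  by exists A' => //; exists B.
left=> _ [A' SA' [B' TB' <-]]; rewrite -!mulmxA.
apply: vec_le_trans _ (SA1 _ SA'); apply: vec_le_mulmx; [exact: S0|exact: TB1].
Qed.

(** Positivity of the dimensions is carried through the induction because [Hset_mul] needs it at
    each series connection. *)
Lemma sp_set_Hset (R : realType) (Q : nat) (r c : 'I_Q -> nat)
    (A : forall i : 'I_Q, set 'M[R]_(r i, c i)) (m n : nat)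
    (e : sp_conn r c m n) :
  (forall i, (0 < r i)%N) -> (forall i, (0 < c i)%N) ->
  (forall i, A i !=set0) -> (forall i, compact (A i)) ->
  (forall i, Hset (A i)) ->
  [/\ (0 < m)%N, (0 < n)%N, sp_set A e !=set0, compact (sp_set A e) &
      Hset (sp_set A e)].
Proof.
move=> r0 c0 A0 cA AH.
elim: e => [i|m1 n1 e1 IH1 e2 IH2|m1 k1 n1 e1 IH1 e2 IH2] /=; first by split.
  case: IH1 IH2 => [m0 n0 [M1 SM1] c1 H1] [_ _ [M2 SM2] c2 H2]; split=> //.
  - by exists (M1 + M2); exists M1 => //; exists M2.
  - by apply: compact_image2 => //; exact: continuous_addmx.
  - exact: Hset_add.
case: IH1 IH2 => [m0 k0 [M1 SM1] c1 H1] [_ n0 [M2 SM2] c2 H2]; split=> //.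
- by exists (M1 *m M2); exists M1 => //; exists M2.
- by apply: compact_image2 => //; exact: continuous_mulmx.
- exact: Hset_mul.
Qed.

(** * From eigenvector inequalities to stability and stabilizability *)

(** In the sup norm weighted by [v], the matrix [A] has operator norm at most [t]; [a] is a bound on
    the norm of [x]. *)
Lemma vec_le_norm_mulmx (R : realType) (n : nat) (A : 'M[R]_n) (x v : 'cV[R]_n)
    (a t : R) :
  mx_pos A -> 0 <= a -> vec_le (A *m v) (t *: v) ->
  (forall i, `|x i 0| <= a * v i 0) ->
  forall i, `|(A *m x) i 0| <= a * t * v i 0.
Proof.
move=> A0 a0 Av xv i; rewrite mxE -mulrA.
have := ler_wpM2l a0 (Av i); rewrite [(t *: v) i 0]mxE; apply: le_trans.
rewrite mxE mulr_sumr; apply: (le_trans (ler_norm_sum _ _ _)).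
apply: ler_sum => j _; rewrite normrM gtr0_norm // mulrCA.
by rewrite ler_wpM2l // ltW.
Qed.

Lemma cvg_scaled_expr0 (R : realType) (t a b : R) :
  0 <= t < 1 -> (a * t ^+ k * b) @[k --> \oo] --> (0 : R).
Proof.
move=> /andP[t0 t1]; rewrite -(mul0r b); apply: cvgMl.
by rewrite -(mulr0 a); apply: cvgMr; apply: cvg_expr; rewrite ger0_norm.
Qed.

Lemma stable_lt1 (R : realType) (n : nat) (S : set 'M[R]_n) (v : 'cV[R]_n)
    (t : R) :
  (forall A, S A -> mx_pos A) -> vec_pos v -> 0 <= t < 1 ->
  (forall A, S A -> vec_le (A *m v) (t *: v)) -> stable S.
Proof.
move=> Spos v0 t01 Sv A SA x xE.
(* The sum of the ratios dominates each of them, so [|x 0|] is at most [a *: v] coordinatewise, and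
   each step gains a factor [t]. *)
pose a := \sum_i `|x 0%N i 0| / v i 0.
have a0 : 0 <= a.
  by apply: sumr_ge0 => i _; rewrite divr_ge0 // ltW.
have xk k : forall i, `|x k i 0| <= a * t ^+ k * v i 0.
  elim: k => [i|k IH i].
    rewrite expr0 mulr1 -ler_pdivrMr // /a (bigD1 i) //= lerDl.
    rewrite sumr_ge0 // => j _.
    by rewrite divr_ge0 // ltW.
  rewrite xE exprSr mulrA; apply: vec_le_norm_mulmx => //; first exact: Spos.
    by rewrite mulr_ge0 // exprn_ge0 //; case/andP: t01.
  exact: Sv.
apply: cvg_mx => i j; rewrite ord1 mxE; apply: norm_cvg0.
apply: (squeeze_cvgr _ (cvg_cst 0) (cvg_scaled_expr0 a (v i 0) t01)).
by near=> k; rewrite normr_ge0 xk.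
Unshelve. all: by end_near. Qed.

Lemma cvgn0_lb_le0 (R : realType) (f : nat -> R) (b : R) :
  f k @[k --> \oo] --> 0 -> (forall k, b <= f k) -> b <= 0.
Proof.
move=> f0 bf; rewrite -(cvg_lim _ f0) //; apply: limr_ge; first exact: cvgP f0.
exact: nearW.
Qed.

(** Under the constant choice [A] the solution [t ^+ k *: v] would stay above [v] if [1 <= t]. *)
Lemma stable_eigen_lt1 (R : realType) (n : nat) (S : set 'M[R]_n) (A : 'M[R]_n)
    (v : 'cV[R]_n) (t : R) :
  (0 < n)%N -> S A -> vec_pos v -> A *m v = t *: v -> stable S -> t < 1.
Proof.
move=> n0 SA v0 Av stS; rewrite ltNge; apply/negP => t1; pose i := Ordinal n0.
have tk k : (t ^+ k.+1) *: v = A *m ((t ^+ k) *: v).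
  by rewrite -scalemxAr Av scalerA exprSr.
have tv0 := stS (fun=> A) (fun=> SA) (fun k => (t ^+ k) *: v) tk.
have := @cvgn0_lb_le0 R (fun k => ((t ^+ k) *: v) i 0) (v i 0).
rewrite leNgt v0 => H; apply/notF/H => [|k].
  by have := @cvg_coord _ _ _ _ _ _ _ i 0 tv0; rewrite mxE.
by rewrite mxE ler_peMl ?exprn_ege1 // ltW.
Qed.

Lemma mx_prod_ge (R : realType) (n : nat) (A : nat -> 'M[R]_n) (v : 'cV[R]_n) :
  (forall k, mx_pos (A k)) -> (forall k, vec_le v (A k *m v)) ->
  forall k, vec_le v (mx_prod A k *m v).
Proof.
move=> A0 Av; elim=> [|k IH] /=; first exact: Av.
by rewrite -mulmxA; apply: vec_le_trans (Av k.+1) _; exact: vec_le_mulmx.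
Qed.

(** If [1 <= t], every matrix of [S] maps [v] above [v], and so does every product. No sequence of
    products can then tend to zero. *)
Lemma stabilizable_lower_lt1 (R : realType) (n : nat) (S : set 'M[R]_n)
    (v : 'cV[R]_n) (t : R) :
  (0 < n)%N -> (forall A, S A -> mx_pos A) -> vec_pos v ->
  (forall A, S A -> vec_le (t *: v) (A *m v)) -> stabilizable S -> t < 1.
Proof.
move=> n0 Spos v0 Sv [A SA A0]; rewrite ltNge; apply/negP => t1.
pose i := Ordinal n0.
have vA k : vec_le v (A k *m v).
  apply: vec_le_trans (Sv _ (SA k)) => j.
  by rewrite mxE ler_peMl // ltW.
have := @cvgn0_lb_le0 R (fun k => (mx_prod A k *m v) i 0) (v i 0).
rewrite leNgt v0 => H; apply/notF/H => [|k]; last first.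
  by apply: mx_prod_ge => // l; exact: Spos.
have Aij j : mx_prod A k i j * v j 0 @[k --> \oo] --> 0 * v j 0.
  apply: cvgMl; have -> : (0 : R) = (0 : 'M[R]_n) i j by rewrite mxE.
  exact: cvg_coord A0.
have : \sum_j mx_prod A k i j * v j 0 @[k --> \oo] --> \sum_j 0 * v j 0.
  exact: (cvg_big (@add_continuous R) _ (fun j _ => Aij j)).
rewrite big1 => [|j _]; last by rewrite mul0r.
rewrite (_ : (fun k => \sum_j _) = fun k => (mx_prod A k *m v) i 0) //.
by apply/funext => k; rewrite mxE.
Qed.

Lemma mx_prod_pos (R : realType) (n : nat) (A : nat -> 'M[R]_n) :
  (forall k, mx_pos (A k)) -> forall k, mx_pos (mx_prod A k).
Proof.
move=> A0; elim=> [|k IH] /=; first exact: A0.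
move=> i j; rewrite mxE (bigD1 i) //= ltr_wpDr //; last first.
  by apply: mulr_gt0; [exact: A0|exact: IH].
by apply: sumr_ge0 => l _; apply/ltW/mulr_gt0; [exact: A0|exact: IH].
Qed.

(** Repeating [A] suffices: one entry of a power, times [v j 0], is a single term of the nonnegative
    sum giving coordinate [i] of the power applied to [v]. *)
Lemma stabilizable_eigen (R : realType) (n : nat) (S : set 'M[R]_n)
    (A : 'M[R]_n) (v : 'cV[R]_n) (t : R) :
  S A -> mx_pos A -> vec_pos v -> A *m v = t *: v -> 0 <= t < 1 ->
  stabilizable S.
Proof.
move=> SA A0 v0 Av t01; exists (fun=> A) => //.
have prodv k : mx_prod (fun=> A) k *m v = (t ^+ k.+1) *: v.
  elim: k => [|k IH] /=; first by rewrite Av.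
  by rewrite -mulmxA IH -scalemxAr Av scalerA [in RHS]exprSr.
have prod0 := mx_prod_pos (fun=> A0).
apply: cvg_mx => i j; rewrite mxE.
(* The leading factor [t] accounts for [mx_prod] at [k] having [k.+1] factors. *)
apply: (squeeze_cvgr _ (cvg_cst 0) (cvg_scaled_expr0 t (v i 0 / v j 0) t01)).
near=> k; rewrite (ltW (prod0 _ _ _)) /= -exprS mulrA ler_pdivlMr //.
have /matrixP/(_ i 0) := prodv k; rewrite [RHS]mxE => <-.
rewrite mxE (bigD1 j) //= lerDl sumr_ge0 // => l _.
by rewrite mulr_ge0 // ltW // prod0.
Unshelve. all: by end_near. Qed.

Theorem theorem3 (R : realType) (Q : nat) (hQ : (1 <= Q)%N)
    (r c : 'I_Q -> nat)
    (hr : forall i, (0 < r i)%N) (hc : forall i, (0 < c i)%N)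
    (A : forall i : 'I_Q, set 'M[R]_(r i, c i))
    (A_nonempty : forall i, A i !=set0)
    (A_compact : forall i, compact (A i))
    (A_Hset : forall i, Hset (A i))
    (N : nat) (e : sp_conn r c N N) (e_once : each_block_once e) :
  (exists rmax : R,
     is_max [set spectral_radius M | M in sp_set A e] rmax /\
     (stable (sp_set A e) <-> rmax < 1)) /\
  (exists rmin : R,
     is_min [set spectral_radius M | M in sp_set A e] rmin /\
     (stabilizable (sp_set A e) <-> rmin < 1)).
Proof.
have [N0 _ S0 cS SH] := sp_set_Hset e hr hc A_nonempty A_compact A_Hset.
have Spos := SH.1.
(* An eigenvector satisfies both inequalities, so the upper and lower bounds on the spectral radius
   meet at [t]. *)
have radius_eigen M x t : sp_set A e M -> vec_pos x -> M *m x = t *: x ->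
    spectral_radius M = t /\ 0 <= t.
  move=> SM x0 Mx; split.
    by apply/eqP; rewrite eq_le (@spectral_radius_le _ _ _ x)
      ?(@spectral_radius_ge _ _ _ x) // ?Mx //; try exact: Spos; move=> i.
  have := mulmx_vec_pos N0 (Spos _ SM) x0 (Ordinal N0).
  by rewrite Mx mxE pmulr_lgt0 // => /ltW.
split.
  (* The single vector [x] bounds all spectral radii by [t], attained at [M], and also serves as the
     common weight for the stability estimate. *)
  have [M [x [t [SM x0 Mx Sx]]]] := Hset_max_eigen N0 S0 cS SH.
  have [Mt t0] := radius_eigen _ _ _ SM x0 Mx; exists t; split.
    split; first by exists M.
    move=> _ [B SB <-]; apply: (spectral_radius_le N0 (Spos _ SB) x0).
    exact: Sx.
  split=> [|t1]; first exact: stable_eigen_lt1 SM x0 Mx.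
  by apply: (stable_lt1 Spos x0 _ Sx); rewrite t0.
(* Dually, [x] bounds all spectral radii and all products from below, while repeating [M] stabilizes
   when [t < 1]. *)
have [M [x [t [SM x0 Mx Sx]]]] := Hset_min_eigen N0 S0 cS SH.
have [Mt t0] := radius_eigen _ _ _ SM x0 Mx; exists t; split.
  split; first by exists M.
  move=> _ [B SB <-]; apply: (spectral_radius_ge N0 (Spos _ SB) x0).
  exact: Sx.
split=> [|t1]; first exact: stabilizable_lower_lt1 Sx.
by apply: (stabilizable_eigen SM (Spos _ SM) x0 Mx); rewrite t0.
Qed.
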